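(* Let $X$ be a finite set with at least three elements, let $(\mathcal T_n)_n$ be a sequence of spheres marked by $X$ and let $\mathcal T$ be a tree of spheres marked by $X$. Then $$\mathcal T_n\to\mathcal T\quad\text{if and only if}\quad \mathfrak B_X([\mathcal T_n])\to\mathfrak B_X([\mathcal T])\ \text{ in }\ \mathbb S^{\mathrm{Quad}_X}.$$
   Context: $\mathbb S=\mathbb P^1(\mathbb C)$. A combinatorial tree marked by $X$ is a finite tree $T$ whose set of leaves is $X$ and all of whose internal vertices have valence $\ge3$. A tree of spheres $\mathcal T$ marked by $X$ is a combinatorial tree $T$ marked by $X$ with, for each internal vertex $v$, a Riemann sphere $\mathbb S_v$ and an injection $i_v$ of the set of edges adjacent to $v$ into $\mathbb S_v$; $a_v:X\to\mathbb S_v$ is $a_v(x)=i_v(e)$ with $e$ the edge at $v$ in the component of $T\setminus\{v\}$ containing $x$. A sphere marked by $X$ is an injection $X\to\mathbb S'$ into a Riemann sphere $\mathbb S'$; it is identified with a tree of spheres with a unique internal vertex $v$, the injection being $a_v$. Isomorphisms of trees of spheres marked by $X$ are adjacency-preserving bijections $M$ of the combinatorial trees (internal vertices to internal vertices, leaves to leaves, edges to edges) that are the identity on $X$, together with projective isomorphisms $m_v:\mathbb S_v\to\mathbb S_{M(v)}$ mapping $i_v(e)$ to $i_{M(v)}(M(e))$; $[\mathcal T]$ denotes the isomorphism class. Convergence: a sequence of marked spheres $x_n:X\to\mathbb S_n$ converges to $\mathcal T$, written $x_n\to\mathcal T$, if for every internal vertex $v$ of $T$ there exist projective isomorphisms $\phi_{n,v}:\mathbb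 S_n\to\mathbb S_v$ such that $\phi_{n,v}\circ x_n$ converges to $a_v$. $\mathrm{Quad}_X$ is the set of quadruples of distinct elements of $X$, and $\mathfrak B_X([\mathcal T])=(\alpha_t(x))_{(t,x)\in\mathrm{Quad}_X}$ where, for $t=(x_0,x_1,x_\infty)$, $v_t$ is the unique vertex such that $x_0,x_1,x_\infty$ lie in different components of $T\setminus\{v_t\}$, $\sigma_t:\mathbb S_{v_t}\to\mathbb S$ is the projective isomorphism sending $a_{v_t}(x_0),a_{v_t}(x_1),a_{v_t}(x_\infty)$ to $0,1,\infty$ respectively, and $\alpha_t=\sigma_t\circ a_{v_t}$. *)

(* Defs.v *)
From HB Require Import structures.
From mathcomp Require Import all_boot all_order all_algebra.
From mathcomp Require Import complex ring.
From mathcomp Require Import boolp classical_sets functions reals topology.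
From mathcomp Require Import normedtype.

Set Implicit Arguments.
Unset Strict Implicit.
Unset Printing Implicit Defensive.

Import Order.TTheory GRing.Theory Num.Theory.

Local Open Scope classical_set_scope.
Local Open Scope ring_scope.

(* P^1(C): [Some z] is the finite point z and [None] the point at infinity.
   The copy [R[i]^o] of the complex numbers carries the topology of the
   modulus. *)
Notation P1 R := (one_point_compactification (R[i]^o)).

Section Spheres.
Variable R : realType.

(* The point with homogeneous coordinates [p : q]. *)
Definition point (p q : R[i]) : P1 R := if q == 0 then None else Some (p / q).

(* z |-> (a z + b) / (c z + d) *)
Definition homography (a b c d : R[i]) (z : P1 R) : P1 R :=
  match z with
  | Some z => point (a * z + b) (c * z + d)
  | None => point a c
  end.

Definition projective_automorphism (f : P1 R -> P1 R) : Prop :=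
  exists a b c d : R[i], a * d - b * c != 0 /\ f = homography a b c d.

Lemma homography_point a b c d p q : (p != 0) || (q != 0) ->
  homography a b c d (point p q) = point (a * p + b * q) (c * p + d * q).
Proof.
rewrite /point; have [->|q0] := eqVneq q 0; rewrite /= /point.
  rewrite orbF => p0; rewrite !mulr0 !addr0 mulf_eq0 (negPf p0) orbF.
  by case: eqVneq => // c0; congr Some; field; rewrite c0 p0.
move=> _; have -> : c * (p / q) + d = (c * p + d * q) / q by field.
rewrite mulf_eq0 invr_eq0 (negPf q0) orbF; case: eqVneq => // n0.
by congr Some; field; rewrite q0 n0.
Qed.

Lemma homography_comp a b c d a' b' c' d' : a' * d' - b' * c' != 0 ->
  homography a b c d \o homography a' b' c' d' =
  homography (a * a' + b * c') (a * b' + b * d')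
             (c * a' + d * c') (c * b' + d * d').
Proof.
move=> det0; apply/funext => -[z|] /=; rewrite homography_point.
- by congr point; ring.
- apply: contraNT det0; rewrite negb_or !negbK => /andP[/eqP p0 /eqP q0].
  apply/eqP; case: (eqVneq a' 0) => [a0|a0].
    have b0 : b' = 0 by rewrite -p0 a0 mul0r add0r.
    by rewrite a0 b0; ring.
  apply: (mulfI a0); rewrite mulr0.
  have -> : b' = - (a' * z) by apply/eqP; rewrite -addr_eq0 addrC p0.
  have -> : d' = - (c' * z) by apply/eqP; rewrite -addr_eq0 addrC q0.
  by ring.
- by [].
- apply: contraNT det0; rewrite negb_or !negbK => /andP[/eqP -> /eqP ->].
  by rewrite mul0r mulr0 subrr.
Qed.

Lemma projective_automorphism_id : projective_automorphism id.
Proof.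
exists 1, 0, 0, 1; split; first by rewrite mulr1 mulr0 subr0 oner_eq0.
apply/funext => -[z|]; rewrite /homography /point ?eqxx //.
by rewrite mul0r add0r oner_eq0 mul1r addr0 divr1.
Qed.

Lemma projective_automorphism_comp f g : projective_automorphism f ->
  projective_automorphism g -> projective_automorphism (f \o g).
Proof.
move=> [a [b [c [d [nf ->]]]]] [a' [b' [c' [d' [ng ->]]]]].
rewrite homography_comp //; do 4![eexists]; split; last by [].
by move: (mulf_neq0 nf ng); congr (_ != 0); ring.
Qed.

Lemma projective_automorphism_inv f : projective_automorphism f ->
  exists g, [/\ cancel f g, cancel g f & projective_automorphism g].
Proof.
move=> [a [b [c [d [n ->]]]]].
have n' : d * a - (- b) * (- c) != 0.
  by move: n; congr (_ != 0); ring.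
have scal k z : k != 0 -> homography k 0 0 k z = z.
  move=> k0; case: z => [z|]; rewrite /homography /point ?eqxx //.
  by rewrite mul0r add0r (negPf k0) addr0 mulrAC divff // mul1r.
exists (homography d (- b) (- c) a); split.
- move=> z; rewrite -[LHS]/((_ \o _) z) homography_comp //.
  rewrite -[RHS](scal (a * d - b * c)) //; congr (homography _ _ _ _ z); ring.
- move=> z; rewrite -[LHS]/((_ \o _) z) homography_comp //.
  rewrite -[RHS](scal (a * d - b * c)) //; congr (homography _ _ _ _ z); ring.
- by exists d, (- b), (- c), a.
Qed.

Definition homeomorphism (S S' : topologicalType) (f : S -> S') : Prop :=
  exists g : S' -> S, [/\ cancel f g, cancel g f, continuous f & continuous g].

(* A Riemann sphere is encoded as a topological space together with the set
   [coord] of its projective isomorphisms onto P^1(C).  This set is an orbit of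
   PGL_2(C) acting by post-composition, so it is the same data as a complex
   structure isomorphic to that of P^1(C).  All coordinates are homeomorphisms
   once one of them is. *)
Record riemann_sphere := RiemannSphere {
  carrier :> topologicalType;
  coord : set (carrier -> P1 R);
  coord_homeo : exists2 s, coord s & homeomorphism s;
  coord_orbit : forall s s', coord s ->
    coord s' <-> exists2 f, projective_automorphism f & s' = f \o s
}.

Lemma coord_bij (S : riemann_sphere) (s : S -> P1 R) :
  coord s -> exists g, cancel s g /\ cancel g s.
Proof.
have [s0 cs0 [g0 [s0K g0K _ _]]] := coord_homeo S.
move=> /(coord_orbit _ cs0)[f /projective_automorphism_inv[g [fK gK _]] ->].
exists (g0 \o g); split=> x /=; first by rewrite fK s0K.
by rewrite g0K gK.
Qed.

Lemma projective_line_homeo :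
  exists2 s : P1 R -> P1 R, projective_automorphism s & homeomorphism s.
Proof.
exists id; first exact: projective_automorphism_id.
by exists id; split=> // x; exact: cvg_id.
Qed.

Lemma projective_line_orbit (s s' : P1 R -> P1 R) : projective_automorphism s ->
  projective_automorphism s' <->
  exists2 f, projective_automorphism f & s' = f \o s.
Proof.
move=> Ps; split=> [Ps'|[f Pf ->]]; last exact: projective_automorphism_comp.
have [g [sK gK Pg]] := projective_automorphism_inv Ps.
exists (s' \o g); first exact: projective_automorphism_comp.
by apply/funext => z /=; rewrite sK.
Qed.

Definition projective_line : riemann_sphere :=
  @RiemannSphere (P1 R) projective_automorphism projective_line_homeo
    projective_line_orbit.

(* [f] is necessarily bijective, because coordinates are. *)
Definition projective_iso (S S' : riemann_sphere) (f : S -> S') : Prop :=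
  forall s, @coord S' s -> @coord S (s \o f).

(* The projective isomorphism S -> P^1(C) that sends p0, p1, poo to 0, 1, oo;
   it exists and is unique when p0, p1, poo are distinct. *)
Definition normalized_coord (S : riemann_sphere) (p0 p1 poo : S) :
    S -> projective_line :=
  xget (fun=> None) [set s : S -> projective_line |
    projective_iso s /\ [/\ s p0 = Some 0, s p1 = Some 1 & s poo = None]].

Lemma projective_iso_id (S : riemann_sphere) : @projective_iso S S id.
Proof. by []. Qed.

Lemma projective_iso_comp (S1 S2 S3 : riemann_sphere) (f : S1 -> S2)
    (g : S2 -> S3) :
  projective_iso f -> projective_iso g -> projective_iso (g \o f).
Proof. by move=> Pf Pg s /Pg /Pf. Qed.

Lemma projective_iso_inv (S S' : riemann_sphere) (f : S -> S') :
  projective_iso f ->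
  exists g, [/\ cancel f g, cancel g f & projective_iso g].
Proof.
move=> Pf; have [s cs _] := coord_homeo S'.
have [s1 [sK _]] := coord_bij cs.
have csf := Pf _ cs.
have [h [hK hK']] := coord_bij csf.
exists (h \o s); split => [x|y|c cc] /=.
- exact: hK.
- by rewrite -[LHS]sK -[s _]/((s \o f) (h (s y))) hK' sK.
- have /(coord_orbit _ csf)[m Pm ->] := cc.
  apply/(coord_orbit _ cs); exists m => //.
  by apply/funext => y /=; rewrite -[s (f _)]/((s \o f) (h (s y))) hK'.
Qed.

End Spheres.

(* The set of vertices is [inner + X]: the internal vertices and the leaves.
   A vertex is a leaf when its valence is 1. *)
Record combinatorial_tree (X : finType) := CombinatorialTree {
  inner : finType;
  adj : rel (inner + X);
  adj_sym : symmetric adj;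
  adj_irr : irreflexive adj;
  adj_connected : forall u w, connect adj u w;
  adj_acyclic : forall p, ucycle adj p -> (size p <= 2)%N;
  leaf_valence : forall x, #|adj (inr x)| = 1%N;
  inner_valence : forall v, (3 <= #|adj (inl v)|)%N
}.
Arguments adj {X} _.

Section Trees.
Variables (X : finType) (T : combinatorial_tree X).
Implicit Type v : inner T.

(* An edge at v is identified with its other endpoint. *)
Definition edge_at v := {w : inner T + X | adj T (inl v) w}.

Definition adj_minus v : rel (inner T + X) :=
  [rel u w | [&& adj T u w, u != inl v & w != inl v]].

(* For u and w different from v: same component of T \ {v}. *)
Definition same_component v : rel (inner T + X) := connect (adj_minus v).

Lemma ex_edge_towards v (x : X) :
  exists e : edge_at v, same_component v (val e) (inr x).
Proof.
have /connectP[p] := adj_connected (inl v : inner T + X) (inr x).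
case/shortenP => -[//|w q] /= /andP[vw wq] /andP[vq _] _ xE.
exists (exist _ w vw); rewrite /same_component xE; apply/connectP; exists q => //=.
move: vq wq; elim: q w {xE vw} => [//|z q IH] w /=.
rewrite !inE !negb_or => /and3P[vw vz vq] /andP[wz zq].
by rewrite /adj_minus /= wz ![_ == inl v]eq_sym vw vz IH // inE negb_or vz.
Qed.

Definition edge_towards v (x : X) : edge_at v := xchoose (ex_edge_towards v x).

Definition separates v (x y z : X) : bool :=
  [&& ~~ same_component v (inr x) (inr y), ~~ same_component v (inr y) (inr z)
    & ~~ same_component v (inr x) (inr z)].

(* When x, y, z are distinct there is exactly one such v. *)
Definition center (x y z : X) : option (inner T) :=
  [pick v | separates v x y z].

End Trees.

Section TreesOfSpheres.
Variables (R : realType) (X : finType).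

Record tree_of_spheres := TreeOfSpheres {
  tree :> combinatorial_tree X;
  sphere_at : inner tree -> riemann_sphere R;
  edge_point : forall v, edge_at v -> sphere_at v;
  edge_point_inj : forall v, injective (@edge_point v)
}.

Definition leaf_point (T : tree_of_spheres) (v : inner T) (x : X) :
  sphere_at v := edge_point (edge_towards v x).

Definition vertex_map (I I' : Type) (M : I -> I') (u : I + X) : I' + X :=
  match u with inl v => inl (M v) | inr x => inr x end.

(* The trees being simple graphs, the bijection between the edges is determined
   by the one between the vertices. *)
Definition tree_isomorphic (T T' : tree_of_spheres) : Prop :=
  exists (M : inner T -> inner T')
         (m : forall v, sphere_at v -> sphere_at (M v)),
  [/\ bijective M,
      forall u w, adj T' (vertex_map M u) (vertex_map M w) = adj T u w,
      forall v, projective_iso (m v) &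
      forall v (e : edge_at v) (e' : edge_at (M v)),
        val e' = vertex_map M (val e) -> m v (edge_point e) = edge_point e'].

Lemma tree_isomorphic_refl T : tree_isomorphic T T.
Proof.
exists id, (fun=> id); split.
- by exists id.
- by move=> [v|x] [w|y].
- by move=> v; exact: projective_iso_id.
- move=> v e e' e'E; congr edge_point; apply: val_inj.
  by rewrite e'E; case: (val e).
Qed.

Lemma tree_isomorphic_trans T1 T2 T3 :
  tree_isomorphic T1 T2 -> tree_isomorphic T2 T3 -> tree_isomorphic T1 T3.
Proof.
move=> [M [m [bM aM pm em]]] [N [n [bN aN pn en]]].
have compE u : vertex_map (N \o M) u = vertex_map N (vertex_map M u) by case: u.
exists (N \o M), (fun v => n (M v) \o m v); split.
- exact: bij_comp.
- by move=> u w; rewrite !compE aN aM.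
- by move=> v; apply: projective_iso_comp.
- move=> v e e'; rewrite compE => e'E /=.
  have a : adj T2 (inl (M v)) (vertex_map M (val e)).
    by rewrite -[inl _]/(vertex_map M (inl v)) aM; case: e {e'E}.
  by rewrite (em v e (exist _ (vertex_map M (val e)) a)) //; apply: en.
Qed.

Lemma tree_isomorphic_sym T T' : tree_isomorphic T T' -> tree_isomorphic T' T.
Proof.
move=> [M [m [[N MK NK] aM pm em]]].
have VK : cancel (vertex_map M) (vertex_map N) by case=> //= v; rewrite MK.
have VK' : cancel (vertex_map N) (vertex_map M) by case=> //= v; rewrite NK.
have aN u w : adj T (vertex_map N u) (vertex_map N w) = adj T' u w.
  by rewrite -aM !VK'.
suff H : forall v' : inner T',
    exists f : sphere_at v' -> sphere_at (N v'), projective_iso f /\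
      forall (e : edge_at v') (e' : edge_at (N v')),
        val e' = vertex_map N (val e) -> f (edge_point e) = edge_point e'.
  have /all_sig[n Hn] := fun v' => cid (H v').
  exists N, n; split => [|//|v|v]; [by exists M|exact: (Hn v).1|exact: (Hn v).2].
move=> v'; rewrite -[v']NK; move: (N v') => v {v'}.
rewrite [N (M v)]MK.
have [f [mK fK Pf]] := projective_iso_inv (pm v).
exists f; split => // e e' e'E.
by rewrite -(em v e' e) ?mK // e'E VK'.
Qed.

Definition tree_class :=
  {C : tree_of_spheres -> Prop | exists T, C = tree_isomorphic T}.

Definition class_of (T : tree_of_spheres) : tree_class :=
  exist _ (tree_isomorphic T) (ex_intro _ T erefl).

(* Quadruples (t, x) with t = (x0, x1, xoo). *)
Definition Quad := {q : (X * X * X) * X |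
  uniq [:: q.1.1.1; q.1.1.2; q.1.2; q.2]}.

(* The last [None] is a dummy value, see [center]. *)
Definition alpha (T : tree_of_spheres) (t : X * X * X) (x : X) : P1 R :=
  let: (x0, x1, xoo) := t in
  if center T x0 x1 xoo is Some v then
    normalized_coord (leaf_point v x0) (leaf_point v x1) (leaf_point v xoo)
      (leaf_point v x)
  else None.

(* [alpha T] depends only on the isomorphism class of T, so [xget] selects the
   common value of [alpha] on the members of the class.  The universe of
   [tree_of_spheres] is too large for a [choiceType], which rules out
   [{eq_quot _}] and [repr]. *)
Definition frakB (c : tree_class) : Quad -> P1 R :=
  xget (fun=> None) [set b | exists2 T : tree_of_spheres, sval c T &
    b = fun q : Quad => alpha T (val q).1 (val q).2].

Record marked_sphere := MarkedSphere {
  sphere : riemann_sphere R;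
  mark : X -> sphere;
  mark_inj : injective mark
}.

Definition sphere_cvg (x : nat -> marked_sphere) (T : tree_of_spheres) : Prop :=
  forall v : inner T, exists phi : forall n, sphere (x n) -> sphere_at v,
    (forall n, projective_iso (phi n)) /\
    {ptws, (fun n => phi n \o @mark (x n)) @ \oo --> @leaf_point T v}.

End TreesOfSpheres.
Arguments class_of {R X} T.

(* The star with center [tt] and set of leaves X. *)
Section Star.
Variables (X : finType) (hX : (2 < #|X|)%N).

Definition star_adj : rel (unit + X) := fun u w =>
  match u, w with inl _, inr _ | inr _, inl _ => true | _, _ => false end.

Lemma star_sym : symmetric star_adj. Proof. by case=> ? []. Qed.

Lemma star_irr : irreflexive star_adj. Proof. by case. Qed.

Lemma star_connected u w : connect star_adj u w.
Proof.
have c v : connect star_adj (inl tt) v.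
  by case: v => [[]|x] //; apply: connect1.
by apply: connect_trans (c w); rewrite (sym_connect_sym star_sym).
Qed.

Lemma star_acyclic p : ucycle star_adj p -> (size p <= 2)%N.
Proof.
case: p => [|a [|b [|c p]]] //; rewrite /ucycle.
case: a b c => [[]|a] [[]|b] [[]|c] //=; first by rewrite andbF.
by case: p => [|[[]|d] p] //=; rewrite !inE /= !andbF.
Qed.

Lemma star_leaf_valence (x : X) : #|star_adj (inr x)| = 1%N.
Proof.
rewrite -(card1 (inl tt : unit + X)).
by apply: eq_card => -[[]|y]; rewrite !inE.
Qed.

Lemma star_inner_valence v : (3 <= #|star_adj (inl v)|)%N.
Proof.
have inj : injective (@inr unit X) by move=> ? ? [].
rewrite (leq_trans hX) // -(card_image inj) subset_leq_card //.
by apply/fintype.subsetP => u /mapP[x _ ->].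
Qed.

Definition star : combinatorial_tree X :=
  CombinatorialTree star_sym star_irr star_connected star_acyclic
    star_leaf_valence star_inner_valence.

Variables (R : realType) (s : marked_sphere R X).

Definition star_point (v : inner star) (e : edge_at v) : sphere s :=
  match e with
  | exist (inr x) _ => mark s x
  | exist (inl u) h => False_rect _ (notF h)
  end.

Lemma star_point_inj v : injective (@star_point v).
Proof.
case=> [[u|x] hx] [[u'|y] hy] //= xy.
by apply: val_inj; rewrite /= (mark_inj xy).
Qed.

Definition tree_of_sphere : tree_of_spheres R X :=
  TreeOfSpheres star_point_inj.

End Star.

(* Main.v *)
Require Import Defs.
From mathcomp Require Import all_boot all_order all_algebra.
From mathcomp Require Import complex ring.
From mathcomp Require Import boolp classical_sets functions reals topology.
From mathcomp Require Import normedtype.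
(* Makes [point], [coord] and [center] denote the notions of marked spheres. *)
Import Defs.

(** Both sides of the equivalence are about the cross-ratios of the marked
    points.

    If [phi n \o mark (x n)] converges to [leaf_point v], where v is the center
    of x0, x1, xoo, then the images of x0, x1, xoo in the limit are distinct.
    Normalized coordinates are invariant under projective isomorphisms, so the
    entry at (x0, x1, xoo, y) is the cross-ratio of the four points transported
    to the sphere at v, and the cross-ratio is continuous where its first three
    arguments are distinct, even if the fourth one collides with one of them
    ([cvg_normalized_coord]).

    Conversely, every internal vertex v has valence at least 3 and is therefore
    the center of some triple of leaves x0, x1, xoo ([center_surj]).  Let s be
    the coordinate of the sphere at v that sends their attaching points to 0, 1,
    oo, and let s_n be the coordinate of the n-th sphere that does the same to
    the marks of x0, x1, xoo.  Then [s^-1 \o s_n] is the required projective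
    isomorphism: convergence at y is the convergence of the entry at
    (x0, x1, xoo, y), except for y among x0, x1, xoo, where the sequence is
    constant.

    Two bodies of facts support this.  On trees: three distinct leaves have
    exactly one center ([separates_unique], [center_exists]).  This makes
    [alpha] meaningful, and invariant under isomorphism ([alpha_iso]), so that
    [frakB] can be computed on any member of the class ([frakBE]).  On P^1(C):
    homographies are continuous for the topology of the one-point
    compactification, so all coordinates of a Riemann sphere are homeomorphisms
    ([coord_homeomorphism]), and any finite set of points avoids oo in some
    coordinate ([finite_coord]), which reduces limits of cross-ratios to limits
    of quotients in C ([cvg_point]). *)

Set Implicit Arguments.
Unset Strict Implicit.
Unset Printing Implicit Defensive.

Import Order.TTheory GRing.Theory Num.Theory.
Import numFieldNormedType.Exports.

Local Open Scope classical_set_scope.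
Local Open Scope ring_scope.

(** * Components of a tree minus a vertex, and centers of triples of leaves *)

Section Components.
Variables (X : finType) (T : combinatorial_tree X).
Implicit Types (v w : inner T) (x y z : X) (a b c : (inner T + X)%type).

Lemma adj_minus_sym v : symmetric (adj_minus v).
Proof.
move=> a b; rewrite /adj_minus /= adj_sym.
by case: (adj T b a) => //=; rewrite andbC.
Qed.

Lemma same_component_refl v a : same_component v a a.
Proof. exact: connect0. Qed.

Lemma same_component_sym v a b : same_component v a b = same_component v b a.
Proof. by rewrite /same_component (sym_connect_sym (adj_minus_sym v)). Qed.

Lemma same_component_trans v b a c :
  same_component v a b -> same_component v b c -> same_component v a c.
Proof. exact: connect_trans. Qed.

Lemma path_adj_minus v a p : path (adj T) a p -> inl v \notin a :: p ->
  path (adj_minus v) a p.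
Proof.
elim: p a => //= b p IH a /andP[ab bp].
rewrite !inE !negb_or => /and3P[va vb vp].
by rewrite /adj_minus /= ab ![_ == inl v]eq_sym va vb IH // inE negb_or vb.
Qed.

Lemma adj_minus_path v a p : path (adj_minus v) a p ->
  path (adj T) a p /\ inl v \notin p.
Proof.
elim: p a => //= b p IH a /andP[/and3P[ab _ bv] /IH[bp vp]].
by rewrite ab inE negb_or eq_sym bv.
Qed.

Lemma same_component_self v a : same_component v a (inl v) -> a = inl v.
Proof.
move/connectP=> [p /adj_minus_path[_ vp] vE].
by case: p vp vE => [//|b p] /= vp vE; rewrite vE mem_last in vp.
Qed.

(** A path between two neighbors of v that avoids v closes up through v to a
    cycle, so the components of T \ {v} are in bijection with the edges at v. *)
Lemma neighbors_in_component v a b : adj T (inl v) a -> adj T (inl v) b ->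
  same_component v a b -> a = b.
Proof.
move=> va vb /connectP[p0 ap0 bE]; subst b.
move: vb; case: (shortenP ap0) => p ap up _ vb.
have [ap' vp] := adj_minus_path ap.
have av : a != inl v by apply: contraTneq va => ->; rewrite adj_irr.
(* A cycle has at most two vertices, so p is empty and last a p = a. *)
suff /adj_acyclic : ucycle (adj T) (inl v :: a :: p).
  by case: p {ap up vb ap' vp}.
apply/andP; split.
  by rewrite /= va rcons_path ap' /= adj_sym.
by rewrite cons_uniq up inE negb_or eq_sym av vp.
Qed.

(** A simple path from a to v that met w would join a to w before reaching v,
    where it ends. *)
Lemma component_switch v w a : v != w -> ~~ same_component v a (inl w) ->
  same_component w a (inl v).
Proof.
move=> vw; apply: contraNT => awv.
have /connectP[p0 ap0 vE] := adj_connected a (inl v).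
case: (shortenP ap0) vE => p ap up _ vE.
have [wp|wp] := boolP (inl w \in a :: p); last first.
  by case/negP: awv; apply/connectP; exists p => //; apply: path_adj_minus.
move: wp ap vE up; rewrite inE => /predU1P[->|wp].
  by rewrite same_component_refl.
case/path.splitP: wp => p1 p2; rewrite cat_path => /andP[ap1 wp2] vE up.
apply/connectP; exists (rcons p1 (inl w)); last by rewrite last_rcons.
apply: path_adj_minus => //; apply: contraL up => vin.
rewrite -cat_cons cat_uniq negb_and negb_and; apply/orP; right; apply/orP; left.
rewrite negbK; apply/hasP; exists (inl v) => //.
rewrite vE last_cat last_rcons; case: p2 {wp2} vE => [|c p2] /=.
  by rewrite cats0 last_rcons => -[E]; rewrite E eqxx in vw.
by move=> _; apply: mem_last.
Qed.

(** By [component_switch], the component of a in T \ {w} contains its component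
    in T \ {v}, and v in addition.  Moving towards w thus terminates, and
    [component_leaf] and [center_exists] argue with extremal vertices. *)
Lemma component_grows v w a : v != w -> a != inl v ->
  ~~ same_component v a (inl w) ->
  (#|[pred b | same_component v a b]| < #|[pred b | same_component w a b]|)%N.
Proof.
move=> vw av avw; have awv := component_switch vw avw.
apply/proper_card/properP; split.
  apply/fintype.subsetP => b; rewrite !inE => avb.
  apply: same_component_trans awv _; rewrite same_component_sym.
  apply: component_switch => //; apply: contra avw; exact: same_component_trans.
exists (inl v); rewrite !inE //; apply: contra av => /same_component_self ->.
by [].
Qed.

(** At most one of x, y, z lies in the component of w in T \ {v}.  The two
    others are joined to v in T \ {w}, hence to each other, so w does not
    separate them. *)
Lemma separates_unique v w x y z : separates v x y z -> separates w x y z ->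
  v = w.
Proof.
move=> /and3P[vxy vyz vxz] /and3P[wxy wyz wxz]; apply: contraTeq isT => vw.
(* At least one of two leaves separated by w lies on the side of w. *)
have off a b : ~~ same_component w a b ->
    same_component v a (inl w) || same_component v b (inl w).
  apply: contraNT; rewrite negb_or => /andP[aw bw].
  apply: same_component_trans (component_switch vw aw) _.
  by rewrite same_component_sym; apply: component_switch.
have two a b : ~~ same_component v a b ->
    ~~ (same_component v a (inl w) && same_component v b (inl w)).
  apply: contra => /andP[aw bw]; apply: same_component_trans aw _.
  by rewrite same_component_sym.
move: (off _ _ wxy) (off _ _ wyz) (off _ _ wxz).
move: (two _ _ vxy) (two _ _ vyz) (two _ _ vxz).
by do 3![case: (same_component _ _ (inl w))].
Qed.

Lemma edge_towardsP v x : same_component v (val (edge_towards v x)) (inr x).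
Proof. exact: (xchooseP (ex_edge_towards v x)). Qed.

Lemma val_edge_towards v x a : adj T (inl v) a -> same_component v a (inr x) ->
  val (edge_towards v x) = a.
Proof.
move=> va ax; apply: (@neighbors_in_component v) => //; first exact: valP.
apply: same_component_trans (edge_towardsP v x) _.
by rewrite same_component_sym.
Qed.

Lemma edge_towards_eq v x y :
  (edge_towards v x = edge_towards v y) <-> same_component v (inr x) (inr y).
Proof.
split=> [E|xy].
  rewrite same_component_sym -(same_component_sym v).
  apply: same_component_trans (edge_towardsP v y).
  by rewrite same_component_sym -E edge_towardsP.
apply: val_inj; apply: val_edge_towards; first exact: valP.
apply: same_component_trans (edge_towardsP v y) _.
by rewrite same_component_sym.
Qed.

Lemma leaf_neighbor x : exists a, adj T (inr x) =i pred1 a.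
Proof. by have [a aE] := mem_card1 (leaf_valence T x); exists a. Qed.

Lemma leaf_isolated v x a : adj T (inr x) (inl v) ->
  same_component v (inr x) a -> a = inr x.
Proof.
move=> xv /connectP[[|b p]] //= /andP[/and3P[xb _ bv] _] _.
have [c cE] := leaf_neighbor x.
move: (cE b) (cE (inl v)); rewrite !inE => bE vE.
move: xb xv; rewrite -!topredE /= in bE vE *; rewrite bE vE => /eqP bc /eqP vc.
by rewrite bc -vc eqxx in bv.
Qed.

(** Two adjacent leaves have no other neighbor, so they form a whole connected
    component. *)
Lemma adjacent_leaves x y a : adj T (inr x) (inr y) -> a \in [:: inr x; inr y].
Proof.
move=> xy; have cl : fingraph.closed (adj T) (mem [:: inr x; inr y]).
  apply: intro_closed; first exact: (sym_connect_sym (@adj_sym _ T)).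
  move=> b c bc; rewrite !inE => /orP[]/eqP bE; move: bc; rewrite bE => bc.
    have [d dE] := leaf_neighbor x.
    move: (dE (inr y)) (dE c); rewrite -!topredE /= xy bc.
    by move=> /esym/eqP-> /esym/eqP->; rewrite eqxx orbT.
  have [d dE] := leaf_neighbor y; rewrite adj_sym in xy.
  move: (dE (inr x)) (dE c); rewrite -!topredE /= xy bc.
  by move=> /esym/eqP-> /esym/eqP->; rewrite eqxx.
by have := closed_connect cl (adj_connected (inr x) a); rewrite !inE eqxx => <-.
Qed.

(** If a is internal, take an internal u in the component of a with the
    component of v in T \ {u} as large as possible.  Some neighbor of u is not on the side
    of v; by maximality it cannot be internal. *)
Lemma component_leaf v a : adj T (inl v) a ->
  exists x, same_component v a (inr x).
Proof.
case: a => [w|x] va; last by exists x; apply: same_component_refl.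
pose P u := (u != v) && same_component v (inl w) (inl u).
have Pw : P w.
  rewrite /P same_component_refl andbT; apply: contraTneq va => ->.
  by rewrite adj_irr.
case: (arg_maxnP (fun u => #|[pred b | same_component u (inl v) b]|) Pw).
move=> u /andP[uv wu] umax.
have [b ub vb] : exists2 b, adj T (inl u) b & ~~ same_component u (inl v) b.
  have /card_gt1P[b [c [ub uc bc]]] : (1 < #|adj T (inl u)|)%N.
    exact: leq_trans (inner_valence u).
  have [vb|] := boolP (same_component u (inl v) b); last by exists b.
  exists c => //; apply: contra bc => vc; apply/eqP.
  apply: (@neighbors_in_component u) => //.
  by apply: same_component_trans vc; rewrite same_component_sym.
have bv : b != inl v by apply: contraNneq vb => ->; apply: same_component_refl.
have wb : same_component v (inl w) b.
  apply: same_component_trans wu _; apply: connect1.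
  by rewrite /adj_minus /= ub bv andbT; apply: contra uv => /eqP[->].
case: b ub vb bv wb => [u'|x] ub vb bv wb; last by exists x.
have uu' : u != u' by apply: contraTneq ub => ->; rewrite adj_irr.
have Pu' : P u' by rewrite /P wb andbT; apply: contra bv => /eqP ->.
have vu : inl v != inl u :> inner T + X.
  by apply: contra uv => /eqP[->].
have := component_grows uu' vu vb; rewrite ltnNge.
by have := umax _ Pu'; rewrite /geq /= => ->.
Qed.

(** A simple path from a to w avoiding v enters w through a neighbor other than
    v, so in T \ {w} the vertex a is on the side of that neighbor. *)
Lemma component_opposite v w a : adj T (inl v) (inl w) ->
  same_component v a (inl w) -> ~~ same_component w a (inl v).
Proof.
move=> vw /connectP[p0 ap0 wE]; case: (shortenP ap0) wE => p ap up _.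
case/lastP: p ap up => [|p b] ap up /=.
  move=> <-; apply/negP; rewrite same_component_sym => /same_component_self vE.
  by rewrite vE adj_irr in vw.
rewrite last_rcons => bE; rewrite -{}bE in ap up.
move: ap up; rewrite rcons_path -rcons_cons rcons_uniq.
move=> /andP[ap /and3P[lw lv _]] /andP[wp _].
have alw : same_component w a (last a p).
  apply/connectP; exists p => //; apply: path_adj_minus => //.
  by have [] := adj_minus_path ap.
apply: contra lv => av; apply/eqP; apply: (@neighbors_in_component w).
- by rewrite adj_sym.
- by rewrite adj_sym.
- by apply: same_component_trans av; rewrite same_component_sym.
Qed.

(** Among the vertices v that separate x from both y and z, such as the neighbor
    of x, one with the largest component of x in T \ {v} also separates y from
    z: otherwise the next vertex on the way to y and z would still separate x
    from them, with a larger component of x. *)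
Lemma center_exists x y z : x != y -> y != z -> x != z ->
  exists v, separates v x y z.
Proof.
move=> xy yz xz.
pose P v := ~~ same_component v (inr x) (inr y) &&
            ~~ same_component v (inr x) (inr z).
have [v0 P0] : exists v, P v.
  have [a aE] := leaf_neighbor x.
  have xa : adj T (inr x) a by have := aE a; rewrite -!topredE /= eqxx.
  case: a xa {aE} => [v|u] xa.
    exists v; apply/andP; split; apply/negP => /(leaf_isolated xa)[E].
      by rewrite E eqxx in xy.
    by rewrite E eqxx in xz.
  (* If x were adjacent to a leaf, y and z would both be that leaf. *)
  have := adjacent_leaves (inr y) xa; have := adjacent_leaves (inr z) xa.
  rewrite !inE => /orP[]/eqP[zE] /orP[]/eqP[yE]; exfalso.
  - by rewrite zE eqxx in xz.
  - by rewrite zE eqxx in xz.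
  - by rewrite yE eqxx in xy.
  - by rewrite zE yE eqxx in yz.
case: (arg_maxnP (fun v => #|[pred b | same_component v (inr x) b]|) P0).
move=> v /andP[vxy vxz] vmax; exists v; rewrite /separates vxy vxz andbT /=.
apply/negP => vyz.
have wy := edge_towardsP v y.
have vw : adj T (inl v) _ := valP (edge_towards v y).
have wz := same_component_trans wy vyz.
case: (val _) vw wy wz => [w|u] vw wy wz; last first.
  rewrite adj_sym in vw; have [E] := leaf_isolated vw wy.
  by have [E'] := leaf_isolated vw wz; rewrite E E' eqxx in yz.
have vw' : v != w by apply: contraTneq vw => ->; rewrite adj_irr.
have xw : ~~ same_component v (inr x) (inl w).
  apply: contra vxy => xw; exact: same_component_trans xw wy.
have far u : same_component v (inl w) (inr u) ->
    ~~ same_component w (inr x) (inr u).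
  rewrite same_component_sym => /(component_opposite vw); apply: contra => xu.
  apply: same_component_trans (component_switch vw' xw).
  by rewrite same_component_sym.
have Pw : P w by rewrite /P !far.
have := component_grows vw' (isT : inr x != inl v) xw; rewrite ltnNge.
by have := vmax _ Pw; rewrite /geq /= => ->.
Qed.

Lemma centerE v x y z : separates v x y z -> center T x y z = Some v.
Proof.
move=> sv; rewrite /center; case: pickP => [w sw|/(_ v)]; last by rewrite sv.
by rewrite (separates_unique sw sv).
Qed.

Lemma center_surj v : exists x y z, separates v x y z.
Proof.
have /card_gt2P[a [b [c [[va vb vc] [ab bc ca]]]]] := inner_valence v.
have [x ax] := component_leaf va; have [y biy] := component_leaf vb.
have [z cz] := component_leaf vc; exists x, y, z.
have sep d e (u t : X) : adj T (inl v) d -> adj T (inl v) e -> d != e ->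
    same_component v d (inr u) -> same_component v e (inr t) ->
    ~~ same_component v (inr u) (inr t).
  move=> vd ve de du ew; apply: contra de => uw; apply/eqP.
  apply: (@neighbors_in_component v) => //.
  apply: same_component_trans du _; apply: same_component_trans uw _.
  by rewrite same_component_sym.
rewrite /separates (sep a b) // (sep b c) // (sep a c) //.
by rewrite eq_sym.
Qed.

Lemma separates_neq v x y z : separates v x y z -> [/\ x != y, y != z & x != z].
Proof.
move=> /and3P[xy yz xz]; split.
- by apply: contraNneq xy => ->; apply: same_component_refl.
- by apply: contraNneq yz => ->; apply: same_component_refl.
- by apply: contraNneq xz => ->; apply: same_component_refl.
Qed.

End Components.

(** * The topology of P^1(C) and normalized coordinates *)

Section Field.
Variable K : numFieldType.

Lemma cvg_quotient (T : Type) (F : set_system T) {FF : Filter F}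
    (f g : T -> K^o) (p q : K^o) :
  f @ F --> p -> g @ F --> q -> q != 0 ->
  (fun t => f t / g t : K^o) @ F --> (p / q : K^o) /\
  \forall t \near F, g t != 0.
Proof.
move=> fp gq q0; split; last exact: (cvgr_neq0 q).
by apply: cvgM => //; apply: cvgV.
Qed.

(** Along (nbhs z, F) the function (z, t) |-> f t - z * g t tends to p, hence is
    eventually nonzero; compactness makes this uniform for z in A. *)
Lemma quotient_escapes (T : Type) (F : set_system T) {FF : Filter F}
    (f g : T -> K^o) (p : K^o) (A : set K^o) :
  compact A ->
  f @ F --> p -> g @ F --> (0 : K^o) -> p != 0 ->
  \forall t \near F, A `<=` (fun z => f t != z * g t).
Proof.
move=> /compact_near_coveringP cA fp g0 p0; apply: cA => z _.
have : (fun x : K^o * T => f x.2 - x.1 * g x.2) @ filter_prod (nbhs z) F -->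
    (p - z * 0 : K^o).
  apply: cvgB; first exact: cvg_comp cvg_snd fp.
  by apply: cvgM; [exact: cvg_fst|exact: cvg_comp cvg_snd g0].
rewrite mulr0 subr0 => /(cvgr_neq0 p)/(_ p0).
apply: filterS => -[u t] /=; apply: contraNN => /eqP ->.
by rewrite subrr.
Qed.

Lemma cvg_affine (T : Type) (F : set_system T) {FF : Filter F}
    (f : T -> K^o) (z a b : K^o) :
  f @ F --> z -> (fun t => a * f t + b : K^o) @ F --> (a * z + b : K^o).
Proof.
move=> fz; apply: (@cvgD _ _ _ _ _ (fun t => a * f t) (fun=> b)).
  by apply: (@cvgM _ _ _ _ (fun=> a) f) => //; apply: cvg_cst.
exact: cvg_cst.
Qed.

Lemma cvg_bracket (T : Type) (F : set_system T) {FF : Filter F}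
    (f1 f2 f3 f4 : T -> K^o) (a1 a2 a3 a4 : K^o) :
  f1 @ F --> a1 -> f2 @ F --> a2 -> f3 @ F --> a3 -> f4 @ F --> a4 ->
  (fun t => (f1 t - f2 t) * (f3 t - f4 t) : K^o) @ F -->
    ((a1 - a2) * (a3 - a4) : K^o).
Proof. by move=> h1 h2 h3 h4; apply: cvgM; apply: cvgB. Qed.

Lemma cvg_near_neq (T : Type) (F : set_system T) {FF : Filter F}
    (f g : T -> K^o) (a b : K^o) : f @ F --> a -> g @ F --> b -> a != b ->
  \forall t \near F, f t != g t.
Proof.
move=> fa gb ab.
have fgab : (fun t => f t - g t) @ F --> (a - b : K^o) by apply: cvgB.
have : \forall t \near F, f t - g t != 0.
  by apply: (cvgr_neq0 (a - b)) => //; rewrite subr_eq0.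
by apply: filterS => t; rewrite subr_eq0.
Qed.

(** The absolute value of the witness exceeds that of every z i. *)
Lemma finite_avoid (I : finType) (z : I -> K) : exists k, forall i, z i != k.
Proof.
exists (1 + \sum_i `|z i|) => i.
have S0 (P : pred I) : 0 <= \sum_(j | P j) `|z j| by apply: sumr_ge0.
apply: contraTneq isT => zE.
suff : `|z i| < `|z i| by rewrite ltxx.
rewrite [X in _ < `|X|]zE [X in _ < X]ger0_norm ?addr_ge0 // (bigD1 i) //=.
by rewrite addrCA ltrDl ltr_pwDl.
Qed.

End Field.

Section Topology.
Variable R : realType.

(** Continuity of [p : q] away from (0, 0).  Where q vanishes, the quotient
    leaves every compact set by [quotient_escapes]. *)
Lemma cvg_point (T : Type) (F : set_system T) {FF : Filter F}
    (f g : T -> R[i]^o) (p q : R[i]^o) :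
  f @ F --> p -> g @ F --> q -> (p != 0) || (q != 0) ->
  (fun t => point (f t) (g t) : P1 R) @ F --> (point p q : P1 R).
Proof.
move=> fp gq; have [q0|q0] := eqVneq q 0; rewrite ?orbF => p0; last first.
  have -> : point p q = Some (p / q) by rewrite /point (negPf q0).
  have [fgpq g0] := cvg_quotient (FF := FF) fp gq q0.
  move=> U /fgpq /(filterI g0); apply: (@filterS _ F) => t [/= gt0 Ut].
  by rewrite /point (negPf gt0).
have -> : point p q = None by rewrite /point q0 eqxx.
move=> U [A [cA _]] AU.
rewrite q0 in gq; have esc := quotient_escapes (FF := FF) cA fp gq p0.
apply: (@filterS _ F) esc => t Aft; apply: AU; rewrite /point.
case: eqVneq => [_|g0]; first by right.
by left; exists (f t / g t) => // /Aft; rewrite divfK ?eqxx.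
Qed.

Lemma cvg_finite (T : Type) (F : set_system T) {FF : Filter F}
    (f : T -> P1 R) (z : R[i]^o) :
  f @ F --> (Some z : P1 R) ->
  (odflt 0 \o f : T -> R[i]^o) @ F --> z /\
  \forall t \near F, f t = Some (odflt 0 (f t)).
Proof.
move=> fz; split.
  move=> U Uz; have /fz : nbhs (Some z : P1 R) (Some @` U).
    exact: one_point_compactification_some_nbhs.
  by apply: (@filterS _ F) => t [u Uu /= <-].
have /fz : nbhs (Some z : P1 R) (Some @` setT).
  by apply: one_point_compactification_some_nbhs; exact: filterT.
by apply: (@filterS _ F) => t [u _ /= <-].
Qed.

(** The disk lies in the square of half side M, the image of a compact set of
    R * R under the continuous map (x, y) |-> x + i y. *)
Lemma compact_disk (M : R) : exists2 A : set R[i]^o,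
  compact A /\ closed A & forall z, `|z| <= M%:C%C -> A z.
Proof.
pose f (xy : R * R) : R[i]^o := (xy.1 +i* xy.2)%C.
pose B : set (R * R) := `[-M, M]%classic `*` `[-M, M]%classic.
have cA : compact (f @` B).
  have cB : compact B by apply: compact_setX; apply: segment_compact.
  apply: continuous_compact cB.
  apply: continuous_subspaceT => -[x0 y0].
  apply/cvgrPdist_lt => e; rewrite ltcE /= => /andP[/eqP e_im e0].
  have -> : e = (complex.Re e)%:C%C by case: e e_im {e0} => u v /= ->.
  have h2 : 0 < complex.Re e / 2 by rewrite divr_gt0.
  near=> xy.
  rewrite normc_def /= ltcR.
  have hx : `|x0 - xy.1| < complex.Re e / 2.
    near: xy; apply: (@cvgr_dist_lt _ _ _ (nbhs (x0, y0)) _ fst x0) => //.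
    exact: cvg_fst.
  have hy : `|y0 - xy.2| < complex.Re e / 2.
    near: xy; apply: (@cvgr_dist_lt _ _ _ (nbhs (x0, y0)) _ snd y0) => //.
    exact: cvg_snd.
  rewrite -ltr_sqr ?nnegrE ?sqrtr_ge0 ?(ltW e0) //.
  rewrite sqr_sqrtr ?addr_ge0 ?sqr_ge0 //.
  rewrite -(real_normK (num_real (x0 - xy.1))).
  rewrite -(real_normK (num_real (y0 - xy.2))).
  rewrite [complex.Re e]splitr.
  move: hx hy (normr_ge0 (x0 - xy.1)) (normr_ge0 (y0 - xy.2)).
  set a := `|_ - xy.1|; set b := `|_ - xy.2|; set c := _ / _ => ha hb a0 b0.
  apply: (@lt_le_trans _ _ (c ^+ 2 + c ^+ 2)).
    by apply: ltrD; rewrite ltr_sqr ?nnegrE ?(ltW h2).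
  by rewrite sqrrD lerD2r lerDl mulrn_wge0 // mulr_ge0 // ltW.
exists (f @` B).
  by split => //; apply: compact_closed => //; exact: norm_hausdorff.
move=> [x y]; rewrite normc_def /= lecR => le; exists (x, y) => //.
rewrite /B /= !in_itv /= -!ler_norml; split; apply: le_trans le.
  by rewrite -sqrtr_sqr ler_wsqrtr // lerDl sqr_ge0.
by rewrite -sqrtr_sqr ler_wsqrtr // lerDr sqr_ge0.
Unshelve. all: by end_near. Qed.

(** The coordinate 1/z around oo; its value 0 at the finite point 0 is
    meaningless. *)
Definition inverse_at_infinity (z : P1 R) : R[i]^o :=
  if z is Some z then z^-1 else 0.

Lemma inverse_at_infinity_cvg :
  inverse_at_infinity @ (None : P1 R) --> (0 : R[i]^o).
Proof.
apply/(@cvgrPdist_lt _ _ _ _ (nbhs_filter (None : P1 R))) => e.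
rewrite ltcE /= => /andP[/eqP e_im e0].
have eE : e = (complex.Re e)%:C%C by case: e e_im {e0} => u v /= ->.
have eC : 0 < e by rewrite eE ltcR.
have [A cA Ain] := compact_disk (complex.Re e)^-1.
exists A => // z [[u Au <-]|->] /=; rewrite sub0r normrN ?normr0 //.
rewrite normfV; have u0 : u != 0.
  apply: contra_notN Au => /eqP ->; apply: Ain.
  by rewrite normr0 lecR invr_ge0 ltW.
rewrite invf_plt ?posrE ?normr_gt0 //.
rewrite real_ltNge ?realV ?gtr0_real ?normr_gt0 //.
apply/negP => ue; apply: Au; apply: Ain; apply: le_trans ue _.
by rewrite {1}eE fmorphV.
Qed.

Lemma point_scale (k p q : R[i]) : k != 0 -> point (k * p) (k * q) = point p q.
Proof.
move=> k0; rewrite /point mulf_eq0 (negPf k0) /=; case: eqVneq => // q0.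
by congr Some; field; rewrite k0 q0.
Qed.

(** At a finite point this is [cvg_point].  Near oo, the homography is
    [b w + a : d w + c] where w = 1/z tends to 0. *)
Lemma homography_continuous (a b c d : R[i]) : a * d - b * c != 0 ->
  continuous (homography a b c d : P1 R -> P1 R).
Proof.
move=> det0 [z|].
  have idz : id @ nbhs z --> z by exact: cvg_id.
  have nz : (a * z + b != 0) || (c * z + d != 0).
    apply: contraNT det0; rewrite negb_or !negbK => /andP[/eqP p0 /eqP q0].
    have -> : a * d - b * c = a * (c * z + d) - c * (a * z + b) by ring.
    by rewrite p0 q0 !mulr0 subr0.
  have lim := cvg_point (cvg_affine (a := a) (b := b) idz)
    (cvg_affine (a := c) (b := d) idz) nz.
  by move=> U /lim.
have inv0 := inverse_at_infinity_cvg.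
have nz : (b * 0 + a != 0) || (d * 0 + c != 0).
  apply: contraNT det0; rewrite negb_or !negbK !mulr0 !add0r.
  by move=> /andP[/eqP -> /eqP ->]; rewrite mul0r mulr0 subr0.
have := cvg_point (cvg_affine (a := b) (b := a) inv0)
  (cvg_affine (a := d) (b := c) inv0) nz.
rewrite !mulr0 !add0r => lim U /lim.
have : \forall z \near (None : P1 R), z != Some 0.
  exists [set (0 : R[i]^o)].
    split; first exact: compact_set1.
    by apply: compact_closed (@compact_set1 _ _); exact: norm_hausdorff.
  move=> _ [[u u0 <-]|->] //; by apply/eqP => -[E]; apply: u0.
move=> H1 H2; apply: filterS2 H1 H2 => -[z|] z0 /= Uz; last first.
  by move: Uz; rewrite !mulr0 !add0r.
have zz : z != 0 by apply: contraNneq z0 => ->.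
congr U: Uz; rewrite -[RHS](@point_scale z^-1) ?invr_eq0 //.
by congr point; field; rewrite ?zz.
Qed.

Lemma coord_homeomorphism (S : riemann_sphere R) (s : S -> P1 R) :
  coord s -> homeomorphism s.
Proof.
have [s0 cs0 [g0 [s0K g0K s0c g0c]]] := coord_homeo S.
move=> /(coord_orbit _ cs0)[f Pf ->].
have [g [fK gK Pg]] := projective_automorphism_inv Pf.
have autc h : projective_automorphism h -> continuous (h : P1 R -> P1 R).
  by move=> [a [b [c [d [n ->]]]]]; apply: homography_continuous.
exists (g0 \o g); split.
- by move=> x /=; rewrite fK s0K.
- by move=> x /=; rewrite g0K gK.
- by move=> x; apply: continuous_comp; [apply: s0c|apply: autc].
- by move=> x; apply: continuous_comp; [apply: autc|apply: g0c].
Qed.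

(** Move to oo a point of P^1(C) outside the finite family. *)
Lemma finite_coord (S : riemann_sphere R) (I : finType) (p : I -> S) :
  exists2 s, @coord R S s & forall i, exists z, s (p i) = Some z.
Proof.
have [s0 cs0 _] := coord_homeo S.
have [k kP] := finite_avoid (fun i => odflt 0 (s0 (p i)) : R[i]).
exists (homography 0 1 1 (- k) \o s0).
  apply/(coord_orbit _ cs0); exists (homography 0 1 1 (- k)) => //.
  by exists 0, 1, 1, (- k); rewrite mul0r mul1r sub0r oppr_eq0 oner_eq0.
move=> i /=; have := kP i; case: (s0 (p i)) => [z|] /= zk; rewrite /point.
  by rewrite mul1r subr_eq0 (negPf zk); eexists.
by rewrite oner_eq0; eexists.
Qed.

Lemma projective_isoP (S : riemann_sphere R) (s : S -> projective_line R) :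
  projective_iso s <-> @coord R S s.
Proof.
split=> [Ps|cs c]; first exact: Ps id (projective_automorphism_id R).
by move=> Pc; apply/(coord_orbit _ cs); exists c.
Qed.

(** A homography fixing oo, 0 and 1 successively has c = 0, b = 0 and a = d. *)
Lemma homography_fix f : projective_automorphism f ->
  f (Some 0) = Some 0 -> f (Some 1) = Some 1 -> f None = None :> P1 R -> f = id.
Proof.
move=> [a [b [c [d [n ->]]]]] /=; rewrite /point !mulr0 !add0r !mulr1.
case: (eqVneq d 0) => // d0 [/eqP]; rewrite mulf_eq0 invr_eq0 (negPf d0) orbF.
move=> /eqP b0; case: (eqVneq c 0) => // c0.
rewrite b0 c0 addr0 add0r (negPf d0).
move=> [ad] _; apply/funext => -[z|] /=; rewrite /point ?eqxx //.
by rewrite mul0r add0r (negPf d0) addr0 mulrAC ad mul1r.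
Qed.

(** The property that [normalized_coord] selects. *)
Definition normalizing (S : riemann_sphere R) (p0 p1 poo : S)
    (s : S -> projective_line R) : Prop :=
  projective_iso s /\ [/\ s p0 = Some 0, s p1 = Some 1 & s poo = None].

Lemma normalizing_unique (S : riemann_sphere R) (p0 p1 poo : S) s s' :
  normalizing p0 p1 poo s -> normalizing p0 p1 poo s' -> s = s'.
Proof.
move=> [/projective_isoP cs [s0 s1 soo]] [/projective_isoP cs' [s0' s1' soo']].
have [f Pf s'E] := (coord_orbit s' cs).1 cs'.
move: s0' s1' soo'; rewrite s'E /= s0 s1 soo => f0 f1 foo.
by rewrite (homography_fix Pf f0 f1 foo).
Qed.

(** Given in homogeneous coordinates: it sends a, b, c to 0, 1, oo. *)
Definition cross_ratio (a b c z : R[i]) : P1 R :=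
  point ((b - c) * (z - a)) ((b - a) * (z - c)).

(** If both homogeneous coordinates of the cross-ratio vanished, then z would be
    equal both to a and to c. *)
Lemma cvg_cross_ratio (T : Type) (F : set_system T) {FF : Filter F}
    (f0 f1 foo f : T -> R[i]^o) (a b c z : R[i]^o) :
  f0 @ F --> a -> f1 @ F --> b -> foo @ F --> c -> f @ F --> z ->
  a != b -> b != c -> a != c ->
  (fun t => cross_ratio (f0 t) (f1 t) (foo t) (f t)) @ F -->
    (cross_ratio a b c z : P1 R).
Proof.
move=> f0a f1b fooc fz ab bc ac.
have N := cvg_bracket (FF := FF) f1b fooc fz f0a.
have D := cvg_bracket (FF := FF) f1b f0a fz fooc.
apply: (cvg_point N D).
rewrite !mulf_eq0 !subr_eq0 (negPf bc) [b == a]eq_sym (negPf ab) /=.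
by case: (eqVneq z a) => [->|].
Qed.

Lemma normalizing_cross_ratio (S : riemann_sphere R) (s : S -> P1 R)
    (p0 p1 poo : S) (a b c : R[i]) : coord s -> a != b -> b != c -> a != c ->
  s p0 = Some a -> s p1 = Some b -> s poo = Some c ->
  exists2 s', normalizing p0 p1 poo s' &
    forall p z, s p = Some z -> s' p = cross_ratio a b c z.
Proof.
move=> cs ab bc ac s0 s1 soo.
set f := homography (b - c) (- ((b - c) * a)) (b - a) (- ((b - a) * c)).
have fE z : f (Some z) = cross_ratio a b c z.
  by rewrite /f /cross_ratio /=; congr point; ring.
exists (f \o s); last by move=> p z /= ->; rewrite fE.
have ba : b - a != 0 by rewrite subr_eq0 eq_sym.
have bc0 : b - c != 0 by rewrite subr_eq0.
have ca : c - a != 0 by rewrite subr_eq0 eq_sym.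
split.
  apply/projective_isoP; apply/(coord_orbit _ cs); exists f => //.
  do 4!eexists; split; last by [].
  have -> : (b - c) * - ((b - a) * c) - - ((b - c) * a) * (b - a) =
            - ((b - c) * (b - a) * (c - a)) by ring.
  by rewrite oppr_eq0 !mulf_neq0.
rewrite /= s0 s1 soo !fE /cross_ratio /point !subrr !mulr0 eqxx !mulf_eq0.
rewrite -[a - c]opprB oppr_eq0 (negPf ba) (negPf bc0) (negPf ca) /= mul0r.
split => //.
by congr Some; field; rewrite ba bc0.
Qed.

(** The cross-ratio formula applies in a coordinate in which all three points
    are finite. *)
Lemma normalizing_exists (S : riemann_sphere R) (p0 p1 poo : S) :
  p0 <> p1 -> p1 <> poo -> p0 <> poo -> exists s, normalizing p0 p1 poo s.
Proof.
move=> p01 p1oo p0oo.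
have [s cs sfin] := finite_coord (fun i : 'I_3 => nth p0 [:: p0; p1; poo] i).
have [/= a sa] := sfin (inord 0); have [b sb] := sfin (inord 1).
have [c sc] := sfin (inord 2); rewrite !inordK //= in sa sb sc.
have [g [sK _]] := coord_bij cs.
have sep p q (u v : R[i]) : p <> q -> s p = Some u -> s q = Some v -> u != v.
  move=> pq su sv; apply/eqP => uv; apply: pq.
  by rewrite -[p]sK -[q]sK su sv uv.
have [s' ? _] := normalizing_cross_ratio cs (sep _ _ _ _ p01 sa sb)
  (sep _ _ _ _ p1oo sb sc) (sep _ _ _ _ p0oo sa sc) sa sb sc.
by exists s'.
Qed.

Lemma normalized_coordP (S : riemann_sphere R) (p0 p1 poo : S) :
  p0 <> p1 -> p1 <> poo -> p0 <> poo ->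
  normalizing p0 p1 poo (normalized_coord p0 p1 poo).
Proof.
by move=> p01 p1oo p0oo; apply: xgetPex; apply: normalizing_exists.
Qed.

Lemma normalized_coordE (S : riemann_sphere R) (p0 p1 poo : S) s :
  normalizing p0 p1 poo s -> normalized_coord p0 p1 poo = s.
Proof.
move=> ns; apply: normalizing_unique (ns).
by apply: (@xgetPex _ _ [set s | normalizing p0 p1 poo s]); exists s.
Qed.

Lemma normalized_coord_iso (S S' : riemann_sphere R) (m : S -> S') p0 p1 poo p :
  projective_iso m -> p0 <> p1 -> p1 <> poo -> p0 <> poo ->
  normalized_coord (m p0) (m p1) (m poo) (m p) = normalized_coord p0 p1 poo p.
Proof.
move=> Pm p01 p1oo p0oo.
have [g [mK _ _]] := projective_iso_inv Pm; have minj := can_inj mK.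
have [Ps [s0 s1 soo]] : normalizing (m p0) (m p1) (m poo)
    (normalized_coord (m p0) (m p1) (m poo)).
  by apply: normalized_coordP => /minj.
have : normalizing p0 p1 poo (normalized_coord (m p0) (m p1) (m poo) \o m).
  by split => //; apply: projective_iso_comp Ps.
by move=> /normalized_coordE ->.
Qed.

(** In a coordinate of the limit sphere in which all the points q j are finite,
    the points phi n (p n j) are eventually finite too, with p n i0, p n i1,
    p n ioo distinct, and the normalized coordinates become explicit
    cross-ratios. *)
Lemma cvg_normalized_coord (S : nat -> riemann_sphere R) (S' : riemann_sphere R)
    (I : finType) (p : forall n, I -> S n) (q : I -> S')
    (phi : forall n, S n -> S') (i0 i1 ioo i : I) :
  (forall n, projective_iso (phi n)) ->
  (forall j, (fun n => phi n (p n j)) @ \oo --> q j) ->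
  q i0 <> q i1 -> q i1 <> q ioo -> q i0 <> q ioo ->
  (fun n => normalized_coord (p n i0) (p n i1) (p n ioo) (p n i) : P1 R) @ \oo
    -->
    (normalized_coord (q i0) (q i1) (q ioo) (q i) : P1 R).
Proof.
move=> Pphi pq q01 q1oo q0oo.
have [s cs sfin] := finite_coord q.
have [z zE] : exists z, forall j, s (q j) = Some (z j).
  by have [z] := choice sfin; exists z.
have [g [sK gK sc gc]] := coord_homeomorphism cs.
have zneq j k : q j <> q k -> z j != z k.
  move=> jk; apply/eqP => zjk; apply: jk.
  by rewrite -[q j]sK -[q k]sK !zE zjk.
have sp j : (fun n => s (phi n (p n j))) @ \oo --> (Some (z j) : P1 R).
  by rewrite -zE; apply: (cvg_comp _ _ (pq j)); apply: sc.
have zn j := cvg_finite (FF := eventually_filter) (sp j).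
pose zz n j : R[i]^o := odflt 0 (s (phi n (p n j))).
have zzc j : (fun n => zz n j) @ \oo --> (z j : R[i]^o) by have [] := zn j.
have zzE j : \forall n \near \oo, s (phi n (p n j)) = Some (zz n j).
  by have [] := zn j.
have zz_neq j k : q j <> q k -> \forall n \near \oo, zz n j != zz n k.
  move=> /zneq; exact: cvg_near_neq.
have limE : normalized_coord (q i0) (q i1) (q ioo) (q i) =
            cross_ratio (z i0) (z i1) (z ioo) (z i).
  have [s' ns' s'E] := normalizing_cross_ratio cs (zneq _ _ q01) (zneq _ _ q1oo)
    (zneq _ _ q0oo) (zE i0) (zE i1) (zE ioo).
  by rewrite (normalized_coordE ns') (s'E _ _ (zE i)).
rewrite limE.
have lim := cvg_cross_ratio (FF := eventually_filter) (zzc i0) (zzc i1)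
  (zzc ioo) (zzc i) (zneq _ _ q01) (zneq _ _ q1oo) (zneq _ _ q0oo).
apply: cvg_trans lim; apply: near_eq_cvg; near=> n.
have e0 : s (phi n (p n i0)) = Some (zz n i0) by near: n.
have e1 : s (phi n (p n i1)) = Some (zz n i1) by near: n.
have eoo : s (phi n (p n ioo)) = Some (zz n ioo) by near: n.
have ei : s (phi n (p n i)) = Some (zz n i) by near: n.
have n01 : zz n i0 != zz n i1 by near: n; apply: zz_neq.
have n1oo : zz n i1 != zz n ioo by near: n; apply: zz_neq.
have n0oo : zz n i0 != zz n ioo by near: n; apply: zz_neq.
have [s' ns' s'E] :=
  normalizing_cross_ratio (Pphi n _ cs) n01 n1oo n0oo e0 e1 eoo.
by rewrite (normalized_coordE ns') (s'E _ _ ei).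
Unshelve. all: by end_near. Qed.

Lemma ptws_cvgP (U T : Type) (V : topologicalType) (F : set_system T)
    {FF : Filter F} (f_ : T -> U -> V) (f : U -> V) :
  {ptws, f_ @ F --> f} <-> forall u, (fun t => f_ t u) @ F --> f u.
Proof.
split=> [Ff u|Ff].
  have H := (cvg_sup _ _ (fmap_filter f_ FF)).1 Ff u.
  move=> A Af; apply: (H ((fun g : U -> V => g u) @^-1` A)).
  exact: (@initial_continuous _ _ (fun g : U -> V => g u)).
apply/cvg_sup => u A.
rewrite /= (@nbhsE (initial_topology (fun g : U -> V => g u))).
move=> -[B [[C oC <-] Cf] BA].
have Cfu : nbhs (f u) C by apply: (@open_nbhs_nbhs V); split.
by apply: (@filterS _ (f_ @ F) _ _ _ BA); exact: (Ff u _ Cfu).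
Qed.

End Topology.

(** * Isomorphism invariance of [alpha], and the theorem *)

Section Iso.
Variable X : finType.

Lemma vertex_map_inj (I I' : Type) (M : I -> I') :
  injective M -> injective (@vertex_map X I I' M).
Proof. by move=> Minj [v|x] [w|y] //= [] => [/Minj ->|->]. Qed.

Lemma same_component_map (T T' : combinatorial_tree X) (M : inner T -> inner T')
    v a b : injective M ->
  (forall a b, adj T' (vertex_map M a) (vertex_map M b) = adj T a b) ->
  same_component v a b ->
  same_component (M v) (vertex_map M a) (vertex_map M b).
Proof.
move=> Minj aM /connectP[p ap ->]; elim: p a ap => /= [a _|b' p IH a].
  exact: same_component_refl.
move=> /andP[/and3P[ab av bv] /IH]; apply: same_component_trans.
have VM := vertex_map_inj Minj.
apply: connect1; rewrite /adj_minus /= aM ab.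
by rewrite -[inl (M v)]/(vertex_map M (inl v)) !(inj_eq VM) av bv.
Qed.

Lemma same_component_iso (T T' : combinatorial_tree X) (M : inner T -> inner T')
    v a b : bijective M ->
  (forall a b, adj T' (vertex_map M a) (vertex_map M b) = adj T a b) ->
  same_component (M v) (vertex_map M a) (vertex_map M b) = same_component v a b.
Proof.
move=> bM aM; apply/idP/idP; last exact: same_component_map (bij_inj bM) aM.
have [N MK NK] := bM.
have VK : cancel (vertex_map M) (@vertex_map X _ _ N).
  by case=> //= w; rewrite MK.
have VK' : cancel (vertex_map N) (@vertex_map X _ _ M).
  by case=> //= w; rewrite NK.
have aN c d : adj T (vertex_map N c) (vertex_map N d) = adj T' c d.
  by rewrite -aM !VK'.
by move/(same_component_map (can_inj NK) aN); rewrite MK !VK.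
Qed.

End Iso.

Section Alpha.
Variables (R : realType) (X : finType).
Implicit Types T : tree_of_spheres R X.

Lemma leaf_point_eq T (v : inner T) x y :
  leaf_point v x = leaf_point v y <-> same_component v (inr x) (inr y).
Proof.
rewrite -edge_towards_eq /leaf_point; split=> [|-> //].
exact: edge_point_inj.
Qed.

Lemma leaf_point_neq T (v : inner T) x y z : separates v x y z ->
  [/\ leaf_point v x <> leaf_point v y, leaf_point v y <> leaf_point v z &
      leaf_point v x <> leaf_point v z].
Proof. by move=> /and3P[xy yz xz]; split=> /leaf_point_eq; apply/negP. Qed.

Lemma alphaE T (v : inner T) x y z u : separates v x y z ->
  alpha T (x, y, z) u =
  normalized_coord (leaf_point v x) (leaf_point v y) (leaf_point v z)
    (leaf_point v u).
Proof. by move=> sv; rewrite /alpha (centerE sv). Qed.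

Lemma alpha_iso T T' x y z u : tree_isomorphic T T' ->
  x != y -> y != z -> x != z -> alpha T (x, y, z) u = alpha T' (x, y, z) u.
Proof.
move=> [M [m [bM aM Pm mE]]] xy yz xz.
have [v sv] := center_exists T xy yz xz.
have sMv : separates (M v) x y z.
  move: sv; rewrite /separates.
  by rewrite -!(same_component_iso (T' := T') _ _ _ bM aM).
have leafM t : leaf_point (M v) t = m v (leaf_point v t).
  symmetry; apply: mE; apply: val_edge_towards.
    by rewrite -[inl (M v)]/(vertex_map M (inl v)) aM; apply: valP.
  rewrite -[inr t]/(vertex_map M (inr t)) same_component_iso //.
  exact: edge_towardsP.
have [lxy lyz lxz] := leaf_point_neq sv.
by rewrite (alphaE _ sv) (alphaE _ sMv) !leafM normalized_coord_iso.
Qed.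

Lemma quad_uniq (x y z u : X) : uniq [:: x; y; z; u] ->
  [/\ x != y, y != z & x != z].
Proof.
rewrite /= !inE !negb_or.
by move=> /and4P[/and3P[-> -> _] /andP[-> _] _ _].
Qed.

(** The value selected by [xget] comes from some isomorphic tree, and [alpha] is
    invariant under isomorphism. *)
Lemma frakBE T (q : Quad X) :
  frakB (class_of T) q = alpha T (val q).1 (val q).2.
Proof.
rewrite /frakB; set B := (X in xget _ X).
have [T' TT' ->] : B (xget (fun=> None) B).
  apply: (@xgetPex _ _ B); exists (fun q => alpha T (val q).1 (val q).2).
  exists T => //.
  exact: tree_isomorphic_refl.
case: q => -[[[x y] z] u] qu; have [xy yz xz] := quad_uniq qu.
by symmetry; apply: alpha_iso.
Qed.

Lemma alpha_sphere (hX : (2 < #|X|)%N) (s : marked_sphere R X) x y z u :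
  x != y -> y != z -> x != z ->
  alpha (tree_of_sphere hX s) (x, y, z) u =
  normalized_coord (mark s x) (mark s y) (mark s z) (mark s u).
Proof.
move=> xy yz xz; set T := tree_of_sphere hX s.
have [v sv] := center_exists T xy yz xz; rewrite (alphaE _ sv).
have leafE t : @leaf_point _ _ T v t = mark s t.
  have : val (edge_towards (v : inner T) t) = inr t.
    apply: val_edge_towards; last exact: same_component_refl.
    by case: (v).
  rewrite /leaf_point; case: (edge_towards _ _) => e e_v /= eE.
  by subst e.
by rewrite !leafE.
Qed.

End Alpha.

Theorem proposition2p17 (R : realType) (X : finType) (hX : (2 < #|X|)%N)
    (x : nat -> marked_sphere R X) (T : tree_of_spheres R X) :
  sphere_cvg x T <->
  {ptws, (fun n => frakB (class_of (tree_of_sphere hX (x n)))) @ \oo -->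
         frakB (class_of T)}.
Proof.
pose B n := frakB (class_of (tree_of_sphere hX (x n))).
split=> [cvgx|cvgB v].
  apply/(ptws_cvgP B) => -[[[[x0 x1] xoo] y] qu].
  have [x01 x1oo x0oo] := quad_uniq qu.
  have [v sv] := center_exists T x01 x1oo x0oo.
  have [phi [Pphi /ptws_cvgP phic]] := cvgx v.
  have [l01 l1oo l0oo] := leaf_point_neq sv.
  rewrite frakBE (alphaE _ sv).
  have lim := cvg_normalized_coord (I := X) (i := y) Pphi phic l01 l1oo l0oo.
  apply: cvg_trans lim; apply: near_eq_cvg; near=> n.
  by rewrite /B frakBE alpha_sphere.
have [x0 [x1 [xoo sv]]] := center_surj v.
have [x01 x1oo x0oo] := separates_neq sv.
have [l01 l1oo l0oo] := leaf_point_neq sv.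
have [Ps [s0 s1 soo]] := normalized_coordP l01 l1oo l0oo.
set s := normalized_coord _ _ _ in Ps s0 s1 soo.
have [g [sK gK Pg]] := projective_iso_inv Ps.
have marks n := @mark_inj _ _ (x n).
have sep n i j : i != j -> mark (x n) i <> mark (x n) j.
  by move=> /eqP ij /marks.
pose sn n := normalized_coord (mark (x n) x0) (mark (x n) x1) (mark (x n) xoo).
have snP n :
    normalizing (mark (x n) x0) (mark (x n) x1) (mark (x n) xoo) (sn n).
  by apply: normalized_coordP; apply: sep.
exists (fun n => g \o sn n); split.
  by move=> n; apply: projective_iso_comp Pg; have [] := snP n.
have gc : continuous (g : P1 R -> sphere_at v).
  have [g' [sK' gK' _ gc']] := coord_homeomorphism ((projective_isoP s).1 Ps).
  suff -> : g = g' by [].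
  by apply/funext => z; rewrite -[RHS]sK gK'.
(* The sequence is constant at the three normalizing leaves. *)
have fixed i w :
    (forall n, sn n (mark (x n) i) = w) -> s (leaf_point v i) = w ->
    (fun n => (g \o sn n \o mark (x n)) i) @ \oo --> leaf_point v i.
  move=> snE sE; rewrite -[leaf_point v i]sK sE.
  apply: cvg_trans (@cvg_cst _ (g w) _ \oo _); apply: near_eq_cvg; near=> n.
  by rewrite /= snE.
apply/(ptws_cvgP (fun n => (g \o sn n) \o @mark _ _ (x n))) => y.
have [->|y0] := eqVneq y x0.
  by apply: fixed s0 => n; have [_ []] := snP n.
have [->|y1] := eqVneq y x1.
  by apply: fixed s1 => n; have [_ []] := snP n.
have [->|yoo] := eqVneq y xoo.
  by apply: fixed soo => n; have [_ []] := snP n.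
have qu : uniq [:: x0; x1; xoo; y].
  by rewrite /= !inE !negb_or x01 x0oo x1oo ![_ == y]eq_sym y0 y1 yoo.
have /(ptws_cvgP B)/(_ (exist _ (x0, x1, xoo, y) qu)) := cvgB.
rewrite frakBE (alphaE _ sv) => lim.
have snc : (fun n => sn n (mark (x n) y) : P1 R) @ \oo -->
    (s (leaf_point v y) : P1 R).
  apply: cvg_trans lim; apply: near_eq_cvg; near=> n.
  by rewrite /B frakBE alpha_sphere.
by rewrite -[leaf_point v y]sK; apply: (cvg_comp _ _ snc); apply: gc.
Unshelve. all: by end_near. Qed.
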